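(* Let $m,n\ge1$, let $A=[a_{ij}]\in\mathbb{C}^{m\times n}$ have only nonzero entries and let $s\in\mathbb{C}^m$, $t\in\mathbb{C}^n$. Define the residual matrix $R=A^{[-1]}-D(s,t)\in\mathbb{C}^{m\times n}$. If $$\beta:=\|A\odot R\|_M<1,$$ then $$\min_{i,j}|s_i-t_j|\ \ge\ \|A\|_M^{-1}(1-\beta),$$ and hence, in particular, $s,t$ are Cauchy points. Moreover, $$\frac{\|A-C(s,t)\|_F}{\|A\|_F}\le\frac{\beta}{1-\beta}.$$
   Context: $A^{[-1]}=[a_{ij}^{-1}]$ is the elementwise inverse of a matrix with nonzero entries; $D(s,t)=[s_i-t_j]\in\mathbb{C}^{m\times n}$; $\odot$ is the Hadamard (elementwise) product; $\|A\|_M=\max_{i,j}|a_{ij}|$; $\|A\|_F=\left(\sum_{i,j}|a_{ij}|^2\right)^{1/2}$. Vectors $s\in\mathbb{C}^m,t\in\mathbb{C}^n$ are called Cauchy points if $s_i-t_j\neq0$ for all $i,j$, and then $C(s,t)=\left[\frac1{s_i-t_j}\right]\in\mathbb{C}^{m\times n}$ is the associated Cauchy matrix. *)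

(* Defs.v *)
From mathcomp Require Import all_boot all_order all_algebra.
From mathcomp Require Import complex.
From mathcomp Require Import reals matrix_normedtype.

Set Implicit Arguments.
Unset Strict Implicit.
Unset Printing Implicit Defensive.

Import Order.TTheory GRing.Theory Num.Theory.
Export Normc.

Local Open Scope ring_scope.
Local Open Scope complex_scope.

(* Norms take values in R: normc z is the modulus of z in R, whereas the
   generic norm of z : R[i] lies in R[i]. *)

Definition hadamard_mx (K : fieldType) (m n : nat) (A B : 'M[K]_(m, n)) :
    'M[K]_(m, n) :=
  map2_mx *%R A B.

Definition elem_inv (K : fieldType) (m n : nat) (A : 'M[K]_(m, n)) :
    'M[K]_(m, n) :=
  map_mx GRing.inv A.

Definition diff_mx (K : fieldType) (m n : nat) (s : 'cV[K]_m) (t : 'cV[K]_n) :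
    'M[K]_(m, n) :=
  \matrix_(i < m, j < n) (s i 0 - t j 0).

Definition cauchy_points (K : fieldType) (m n : nat)
    (s : 'cV[K]_m) (t : 'cV[K]_n) : Prop :=
  forall i j, s i 0 - t j 0 != 0.

(* Meaningful for Cauchy points; elsewhere entries follow 0^-1 = 0. *)
Definition cauchy_mx (K : fieldType) (m n : nat) (s : 'cV[K]_m) (t : 'cV[K]_n) :
    'M[K]_(m, n) :=
  \matrix_(i < m, j < n) (1 / (s i 0 - t j 0)).

(* mx_norm is the maximum of the absolute values of the entries. *)
Definition max_norm (R : realType) (m n : nat) (A : 'M[R[i]]_(m, n)) : R :=
  mx_norm (map_mx (@normc R) A).

Definition frob_norm (R : realType) (m n : nat) (A : 'M[R[i]]_(m, n)) : R :=
  Num.sqrt (\sum_(i < m) \sum_(j < n) normc (A i j) ^+ 2).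

(* The default value is one of the entries, so this is the minimum of the
   moduli; dimensions are successors because an empty minimum has no value. *)
Definition min_modulus (R : realType) (m n : nat)
    (A : 'M[R[i]]_(m.+1, n.+1)) : R :=
  \big[Num.min/normc (A ord0 ord0)]_(p : 'I_m.+1 * 'I_n.+1) normc (A p.1 p.2).

(* Main.v *)
Require Import Defs.
From mathcomp Require Import all_boot all_order all_algebra.
From mathcomp Require Import complex reals.
From mathcomp Require Import matrix_normedtype.

(** Everything happens entrywise.  For one entry a of A and the matching
    difference d = s_i - t_j, the entry of A o Res is a * (a^-1 - d) = 1 - a d,
    so beta bounds the relative residual |1 - a d|.  Since that residual is
    below 1, the product a d stays away from zero, |a d| >= 1 - beta
    ([normc_mul_ge]); dividing by |a| <= max_norm A bounds |d| from below, hence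
    d is nonzero and the minimum is bounded as well.  Once d is known to be
    nonzero, a - 1/d = - a (1 - a d) / (a d), so every entry of A is approximated
    with relative error at most beta / (1 - beta) ([normc_sub_inv_le]).  Such a
    uniform relative entrywise bound passes to the Frobenius norm by
    monotonicity and homogeneity ([frob_norm_le]). *)

Import Order.TTheory GRing.Theory Num.Theory.

Local Open Scope ring_scope.
Local Open Scope complex_scope.

(** * Modulus estimates for a single entry *)

Lemma normc_ge0 (R : rcfType) (z : R[i]) : 0 <= normc z.
Proof. by case: z => a b; rewrite sqrtr_ge0. Qed.

Lemma normc_gt0 (R : rcfType) (z : R[i]) : (0 < normc z) = (z != 0).
Proof.
rewrite lt0r normc_ge0 andbT; congr (~~ _); apply/eqP/eqP => [/eq0_normc //|->].
exact: normc0.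
Qed.

(** The reverse triangle inequality around 1, as 1 = a d + (1 - a d). *)
Lemma normc_mul_ge (R : rcfType) (a d : R[i]) (b : R) :
  normc (1 - a * d) <= b -> 1 - b <= normc a * normc d.
Proof.
move=> res_le; rewrite -normcM lerBlDr -(normc1 R).
rewrite -[X in normc X <= _](subrK (a * d)) addrC.
by apply: le_trans (le_normcD _ _) _; rewrite lerD2l.
Qed.

(** The error factors as a - 1/d = - a (1 - a d) / (a d), where the numerator
    is controlled by the residual and the denominator by [normc_mul_ge]. *)
Lemma normc_sub_inv_le (R : rcfType) (a d : R[i]) (b : R) :
  a != 0 -> d != 0 -> b < 1 -> normc (1 - a * d) <= b ->
  normc (a - 1 / d) <= b / (1 - b) * normc a.
Proof.
move=> a0 d0 b1 res_le.
have b'_gt0 : 0 < 1 - b by rewrite subr_gt0.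
have -> : a - 1 / d = - (a * ((1 - a * d) / (a * d))).
  rewrite mulrA invfM mulrA [a * _]mulrC mulfK //.
  by rewrite mulrBl -mulrA divff // mulr1 opprB.
rewrite normcN normcM mulrC ler_wpM2r ?normc_ge0 // normcM normcV.
apply: ler_pM => //; rewrite ?invr_ge0 ?normc_ge0 //.
rewrite lef_pV2 ?posrE ?normc_gt0 ?mulf_neq0 //.
by rewrite normcM normc_mul_ge.
Qed.

(** * Entrywise bounds and matrix norms *)

Lemma normc_le_max_norm (R : realType) (m n : nat) (A : 'M[R[i]]_(m, n)) i j :
  normc (A i j) <= max_norm A.
Proof.
rewrite /max_norm mx_normrE (le_trans _ (le_bigmax _ _ (i, j))) //=.
by rewrite mxE ler_norm.
Qed.

Lemma min_modulus_ge (R : realType) (m n : nat) (A : 'M[R[i]]_(m.+1, n.+1)) c :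
  (forall i j, c <= normc (A i j)) -> c <= min_modulus A.
Proof.
move=> cA; rewrite /min_modulus.
by elim/big_ind: _ => // x y cx cy; rewrite le_min cx.
Qed.

Lemma frob_norm_le (R : realType) (m n : nat) (A B : 'M[R[i]]_(m, n)) (c : R) :
  0 <= c -> (forall i j, normc (A i j) <= c * normc (B i j)) ->
  frob_norm A <= c * frob_norm B.
Proof.
move=> c0 AB; rewrite /frob_norm -[X in _ <= X * _](ger0_norm c0).
rewrite -sqrtr_sqr -sqrtrM ?sqr_ge0 //.
apply: ler_wsqrtr; rewrite mulr_sumr; apply: ler_sum => i _.
rewrite mulr_sumr; apply: ler_sum => j _.
by rewrite -exprMn ler_pXn2r ?nnegrE ?normc_ge0 // mulr_ge0 ?normc_ge0.
Qed.

Lemma frob_norm_gt0 (R : realType) (m n : nat) (A : 'M[R[i]]_(m, n)) i j :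
  A i j != 0 -> 0 < frob_norm A.
Proof.
rewrite -normc_gt0 => Aij.
rewrite /frob_norm sqrtr_gt0 (bigD1 i) //= (bigD1 j) //=.
rewrite -addrA ltr_wpDr ?exprn_gt0 // addr_ge0 // ?sumr_ge0 //.
  by move=> k _; rewrite sqr_ge0.
by move=> k _; apply: sumr_ge0 => l _; rewrite sqr_ge0.
Qed.

(** * Approximation by a Cauchy matrix *)

Theorem theorem3p5 (R : realType) (m n : nat) (A : 'M[R[i]]_(m.+1, n.+1))
    (s : 'cV[R[i]]_m.+1) (t : 'cV[R[i]]_n.+1)
    (hA : forall i j, A i j != 0) :
  let Res := elem_inv A - diff_mx s t in
  let beta := max_norm (hadamard_mx A Res) in
  beta < 1 ->
  [/\ min_modulus (diff_mx s t) >= (max_norm A)^-1 * (1 - beta),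
      cauchy_points s t
    & frob_norm (A - cauchy_mx s t) / frob_norm A <= beta / (1 - beta)].
Proof.
move=> Res beta beta1.
have b'_gt0 : 0 < 1 - beta by rewrite subr_gt0.
have res_le i j : normc (1 - A i j * (s i 0 - t j 0)) <= beta.
  apply: le_trans (normc_le_max_norm _ _ _ (hadamard_mx A Res) i j).
  by rewrite !mxE [X in _ <= normc X]mulrBr divff.
have beta0 : 0 <= beta := le_trans (normc_ge0 _ _) (res_le ord0 ord0).
have max_gt0 : 0 < max_norm A.
  apply: lt_le_trans (normc_le_max_norm _ _ _ A ord0 ord0).
  by rewrite normc_gt0.
have diff_ge i j : (max_norm A)^-1 * (1 - beta) <= normc (s i 0 - t j 0).
  rewrite ler_pdivrMl //; apply: le_trans (normc_mul_ge _ _ _ _ (res_le i j)) _.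
  by rewrite ler_wpM2r ?normc_ge0 ?normc_le_max_norm.
have diff_neq0 : cauchy_points s t.
  move=> i j; rewrite -normc_gt0; apply: lt_le_trans (diff_ge i j).
  by rewrite mulr_gt0 ?invr_gt0.
split=> //; first by apply: min_modulus_ge => i j; rewrite mxE.
rewrite ler_pdivrMr; last exact: (frob_norm_gt0 _ _ _ _ ord0 ord0).
apply: frob_norm_le => [|i j]; first by rewrite divr_ge0 // ltW.
by rewrite !mxE; apply: normc_sub_inv_le.
Qed.
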